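(* The norm of the Hilbert matrix operator $\mathcal{H}$ acting from the Hardy space $H^1$ into the logarithmically weighted Hardy space $H^1_{\log}$ satisfies the lower bound $$\|\mathcal{H}\|_{H^1\to H^1_{\log}}\ge \pi.$$
   Context: Let $\mathbb{D}$ be the open unit disk of $\mathbb{C}$ and $H(\mathbb{D})$ the set of all analytic functions in $\mathbb{D}$. For $f(z)=\sum_{k=0}^\infty a_kz^k\in H(\mathbb{D})$, the Hilbert matrix operator is defined by $$\mathcal{H}f(z)=\sum_{n=0}^\infty\left(\sum_{k=0}^\infty\frac{a_k}{n+k+1}\right)z^n,$$ whenever the right-hand side makes sense (the inner series converging as ordinary limits of partial sums) and defines an analytic function in $\mathbb{D}$. For $f\in H(\mathbb{D})$ and $0\le r<1$ put $M_1(r,f)=\frac{1}{2\pi}\int_0^{2\pi}|f(re^{it})|\,dt$. The Hardy space $H^1$ consists of all $f\in H(\mathbb{D})$ with $\|f\|_{H^1}=\sup_{0\le r<1}M_1(r,f)<\infty$. The logarithmically weighted Hardy space $H^1_{\log}$ consists of all $f\in H(\mathbb{D})$ with $$\|f\|_{H^1_{\log}}=\sup_{0\le r<1}\left(\log\frac{e}{(1-r)^2}\right)^{-1}M_1(r,f)<\infty.$$ The operator norm is $\|\mathcal{H}\|_{H^1\to H^1_{\log}}=\sup\{\|\mathcal{H}f\|_{H^1_{\log}}/\|f\|_{H^1}: 0\ne f\in H^1\}$. *)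

(* Defs.v *)
From Stdlib Require Import Reals.
From Coquelicot Require Import Coquelicot.

Open Scope R_scope.

(* Elements of H(D) are total functions [C -> C]; only their restriction to the
   open unit disk is ever used. *)
Definition in_disk (z : C) : Prop := Cmod z < 1.

Definition analytic_on_disk (f : C -> C) : Prop :=
  forall z : C, in_disk z -> @ex_derive C_AbsRing C_NormedModule f z.

Definition has_power_series (f : C -> C) (a : nat -> C) : Prop :=
  forall z : C, in_disk z -> @is_pseries C_AbsRing C_NormedModule a z (f z).

(* [is_Hilbert f g]: the Hilbert matrix operator is defined at [f], with value
   [g]. It is a relation because the operator is partial; [g] is determined on
   the disk, since the Taylor coefficients of [f] are unique. *)
Definition is_Hilbert (f g : C -> C) : Prop :=
  analytic_on_disk f /\ analytic_on_disk g /\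
  exists a b : nat -> C,
    has_power_series f a /\
    (forall n : nat,
        @is_series C_AbsRing C_NormedModule
          (fun k : nat => Cdiv (a k) (RtoC (INR (n + k + 1)))) (b n)) /\
    has_power_series g b.

(* The integrand is continuous when [f] is analytic in the disk and
   [0 <= r < 1], so the total operator [RInt] is the genuine integral here. *)
Definition M1 (r : R) (f : C -> C) : R :=
  / (2 * PI) *
  RInt (fun t : R => Cmod (f (r * cos t, r * sin t))) 0 (2 * PI).

Definition H1_norm (f : C -> C) : Rbar :=
  Lub_Rbar (fun x : R => exists r : R, 0 <= r < 1 /\ x = M1 r f).

Definition H1log_norm (f : C -> C) : Rbar :=
  Lub_Rbar (fun x : R => exists r : R,
    0 <= r < 1 /\ x = / ln (exp 1 / (1 - r) ^ 2) * M1 r f).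

Definition in_H1 (f : C -> C) : Prop :=
  analytic_on_disk f /\ Rbar_lt (H1_norm f) p_infty.

Definition nonzero_on_disk (f : C -> C) : Prop :=
  exists z : C, in_disk z /\ f z <> RtoC 0.

(* In each quotient the denominator is a positive real number. *)
Definition Hilbert_norm_H1_H1log : Rbar :=
  Rbar_lub (fun q : Rbar => exists f g : C -> C,
    in_H1 f /\ nonzero_on_disk f /\ is_Hilbert f g /\
    q = Rbar_div (H1log_norm g) (H1_norm f)).

(* Main.v *)
Require Import Defs.
From Stdlib Require Import Reals Lra Lia.
From Coquelicot Require Import Coquelicot.
Open Scope R_scope.

(** Only the circle of radius [0] matters. There the logarithmic weight is [1]
    and the mean [M1 0 g] is [|g(0)|], so the norm of [g] in the weighted space
    is at least [|g(0)|]. When [g] is the Hilbert transform of [f], the number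
    [g(0) = sum_k a_k / (k + 1)] is the integral of [f] over [[0, 1]], and the
    Fejer-Riesz inequality bounds it by [PI] times the [H^1] norm of [f]. This
    constant is approached by functions that look like [1 / (1 - z)] near the
    end point [1], where both sides are dominated by a logarithm.

    The family used is [f(z) = 1 / (1 - rho z)] with [rho] tending to [1]. Put
    [L = - ln (1 - rho)].
    - [g(0) = sum_k rho^k / (k + 1)] is at least [L], by integrating the
      geometric series ([log_le_kernel_Hilbert_coeff]).
    - [f] has [H^1] norm at most [L / PI + 6]: on the circle of radius [r], with
      [s = rho r], the mean of [1 / |1 - s e^(it)|] behaves like that of
      [1 / sqrt ((1 - s)^2 + s t^2)], whose primitive is a logarithm
      ([mean_inv_chord_le]).
    Hence the operator norm is at least [L / (L / PI + 6)], which tends to [PI]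
    ([Hilbert_norm_ge]).

    The Hilbert transform of [f] has to be an analytic function on the disk. Its
    coefficients are bounded, so this follows from complex differentiability of
    power series with bounded coefficients ([analytic_of_power_series]). *)

(** * Complex series *)

Notation is_series_C := (@is_series C_AbsRing C_NormedModule).

Lemma pow_n_Cpow (z : C) (n : nat) : @pow_n C_AbsRing z n = (z ^ n)%C.
Proof.
  induction n as [|n IH]; [reflexivity|].
  rewrite Cpow_S, <- IH; reflexivity.
Qed.

Lemma is_pseries_C (a : nat -> C) (z l : C) :
  @is_pseries C_AbsRing C_NormedModule a z l <->
  is_series_C (fun n => (z ^ n * a n)%C) l.
Proof.
  assert (E : forall n, (z ^ n * a n)%C
     = scal (pow_n (z : C_AbsRing) n) (a n : C_NormedModule)).
  { intro n; rewrite <- pow_n_Cpow; reflexivity. }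
  split; intro H.
  - eapply is_series_ext; [|exact H]. intro n; symmetry; apply E.
  - eapply is_series_ext; [|exact H]. exact E.
Qed.

Lemma is_series_norm_le {K : AbsRing} {V : NormedModule K}
    (a : nat -> V) (u : nat -> R) (l : V) (s : R) :
  (forall n, norm (a n) <= u n) -> is_series a l -> is_series u s -> norm l <= s.
Proof.
  intros Hle Ha Hu.
  apply (is_lim_seq_le (fun n => norm (sum_n a n)) (sum_n u) (norm l) s).
  - intro n. eapply Rle_trans; [apply norm_sum_n_m|].
    apply sum_n_m_le; exact Hle.
  - exact (filterlim_comp _ _ _ _ _ _ _ _ Ha (filterlim_norm l)).
  - exact Hu.
Qed.

Lemma is_series_RtoC (a : nat -> R) (l : R) :
  is_series a l -> is_series_C (fun n => RtoC (a n)) (RtoC l).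
Proof.
  intro H.
  assert (E : forall n, RtoC (sum_n a n)
      = @sum_n C_NormedModule (fun k => RtoC (a k)) n).
  { induction n as [|n IH]; [now rewrite !sum_O|].
    rewrite !sum_Sn, <- IH. apply RtoC_plus. }
  unfold is_series.
  eapply filterlim_ext; [exact E|].
  apply (filterlim_comp _ _ _ (sum_n a) RtoC _ (locally l)); [exact H|].
  apply filterlim_locally; intro eps.
  exists eps. intros y Hy. split; [exact Hy|apply ball_center].
Qed.

(** * Power series with bounded coefficients are analytic *)

(** Second-order Taylor estimate for powers, uniform on the closed disk of
    radius [r]. The induction uses that the remainders satisfy
    [E_(n+1) = w E_n + n z^(n-1) (w - z)^2]. The factor [r ^ 2] on the left
    stands for the [r ^ (n - 2)] one expects on the right and spares a truncated
    exponent. *)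
Lemma Cpow_remainder (z w : C) (r : R) (n : nat) :
  0 < r -> Cmod z <= r -> Cmod w <= r ->
  r ^ 2 * Cmod (w ^ n - z ^ n - (w - z) * (RtoC (INR n) * z ^ (pred n)))
    <= INR n ^ 2 * r ^ n * Cmod (w - z) ^ 2.
Proof.
  intros Hr Hz Hw.
  induction n as [|n IH].
  - simpl. match goal with |- context [Cmod ?x] => replace x with (RtoC 0) by ring end.
    rewrite Cmod_0. lra.
  - set (E := (w ^ n - z ^ n - (w - z) * (RtoC (INR n) * z ^ pred n))%C) in *.
    assert (Hsplit : (w ^ S n - z ^ S n - (w - z) * (RtoC (INR (S n)) * z ^ pred (S n)))%C
      = (w * E + (w - z) ^ 2 * (RtoC (INR n) * z ^ pred n))%C).
    { unfold E. rewrite S_INR, RtoC_plus, !Cpow_S.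
      destruct n as [|n]; simpl pred; rewrite ?Cpow_S; [simpl INR|]; ring. }
    rewrite Hsplit.
    assert (Hd : r * Cmod (RtoC (INR n) * z ^ pred n) <= INR n * r ^ n).
    { rewrite Cmod_mult, Cmod_R, Cmod_pow, (Rabs_pos_eq _ (pos_INR n)).
      destruct n as [|n]; [simpl; lra|]. simpl pred.
      assert (Cmod z ^ n <= r ^ n) by (apply pow_incr; split; [apply Cmod_ge_0|lra]).
      replace (r * (INR (S n) * Cmod z ^ n)) with (INR (S n) * (r * Cmod z ^ n)) by ring.
      apply Rmult_le_compat_l; [apply pos_INR|].
      apply (Rmult_le_compat_l r); [lra|assumption]. }
    set (D := Cmod (RtoC (INR n) * z ^ pred n)) in *.
    pose proof (Cmod_triangle (w * E) ((w - z) ^ 2 * (RtoC (INR n) * z ^ pred n))) as T.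
    rewrite (Cmod_mult w E), (Cmod_mult ((w - z) ^ 2)), (Cmod_pow (w - z)) in T.
    fold D in T.
    set (h := Cmod (w - z)) in *.
    assert (Hh : 0 <= h ^ 2) by apply pow2_ge_0.
    pose proof (Cmod_ge_0 E) as HE.
    rewrite S_INR. pose proof (pos_INR n) as Hn. pose proof (pow_lt r n Hr) as Hp.
    simpl (r ^ S n).
    assert (A1 : r ^ 2 * (Cmod w * Cmod E) <= r * (INR n ^ 2 * r ^ n * h ^ 2)).
    { apply Rle_trans with (r * (r ^ 2 * Cmod E)); [|apply Rmult_le_compat_l; lra].
      pose proof (pow2_ge_0 r). assert (0 <= r ^ 2 * Cmod E) by (apply Rmult_le_pos; lra).
      nra. }
    assert (A2 : r ^ 2 * (h ^ 2 * D) <= r * h ^ 2 * (INR n * r ^ n)).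
    { replace (r ^ 2 * (h ^ 2 * D)) with (r * h ^ 2 * (r * D)) by ring.
      apply Rmult_le_compat_l; [apply Rmult_le_pos; lra|exact Hd]. }
    assert (A3 : 0 <= (INR n + 1) * (r * r ^ n * h ^ 2)).
    { apply Rmult_le_pos; [lra|]. apply Rmult_le_pos; [|exact Hh].
      apply Rmult_le_pos; lra. }
    assert (A4 : r ^ 2 * Cmod (w * E + (w - z) ^ 2 * (RtoC (INR n) * z ^ pred n))
      <= r ^ 2 * (Cmod w * Cmod E + h ^ 2 * D)).
    { apply Rmult_le_compat_l; [apply pow2_ge_0|exact T]. }
    nra.
Qed.

Lemma ex_series_sqr_geom (r : R) : 0 < r < 1 -> ex_series (fun n => INR n ^ 2 * r ^ n).
Proof.
  intro Hr.
  apply ex_series_incr_1.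
  apply ex_series_ext with (fun n => Rabs (INR (S n) ^ 2 * r ^ S n)).
  { intro n. apply Rabs_pos_eq, Rmult_le_pos; [apply pow2_ge_0|apply pow_le; lra]. }
  apply (ex_series_DAlembert (fun n => INR (S n) ^ 2 * r ^ S n) r); [lra| |].
  - intro n. apply Rmult_integral_contrapositive_currified; apply pow_nonzero;
      [apply not_0_INR; lia|lra].
  - apply is_lim_seq_ext with (fun n => r * (1 + / INR (S n)) ^ 2).
    + intro n. pose proof (pos_INR n).
      rewrite Rabs_pos_eq.
      * rewrite !S_INR. simpl. field. repeat split; try lra. apply pow_nonzero; lra.
      * apply Rlt_le, Rdiv_lt_0_compat; apply Rmult_lt_0_compat; apply pow_lt; try lra;
          apply lt_0_INR; lia.
    + replace (Finite r) with (Rbar_mult r (Finite ((1 + 0) * ((1 + 0) * 1)))) by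
        (simpl; f_equal; ring).
      apply is_lim_seq_scal_l. simpl pow.
      assert (is_lim_seq (fun n => 1 + / INR (S n)) (1 + 0)).
      { apply is_lim_seq_plus'; [apply is_lim_seq_const|].
        apply -> (is_lim_seq_incr_1 (fun n => / INR n)).
        replace (Finite 0) with (Rbar_inv p_infty) by reflexivity.
        apply is_lim_seq_inv; [apply is_lim_seq_INR|discriminate]. }
      apply is_lim_seq_mult'; [assumption|].
      apply is_lim_seq_mult'; [assumption|apply is_lim_seq_const].
Qed.

Lemma ex_pseries_bounded (a : nat -> C) (B : R) (z : C) :
  (forall n, Cmod (a n) <= B) -> in_disk z ->
  @ex_pseries C_AbsRing C_NormedModule a z.
Proof.
  intros HB Hz. unfold in_disk in Hz.
  apply (@ex_series_le C_AbsRing C_CompleteNormedModule _ (fun n => Cmod z ^ n * B)).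
  - intro n. rewrite pow_n_Cpow.
    change (Cmod (z ^ n * a n) <= Cmod z ^ n * B).
    rewrite Cmod_mult, Cmod_pow.
    apply Rmult_le_compat_l; [apply pow_le, Cmod_ge_0|apply HB].
  - apply ex_series_scal_r. exists (/ (1 - Cmod z)).
    apply is_series_geom. rewrite Rabs_pos_eq; [exact Hz|apply Cmod_ge_0].
Qed.

(** The sum is selected by a description operator, since convergence alone does
    not name a value. *)
Lemma has_power_series_exists (a : nat -> C) (B : R) :
  (forall n, Cmod (a n) <= B) -> exists f, has_power_series f a.
Proof.
  intro HB.
  exists (fun z => @iota C_CompleteNormedModule
    (fun l => @is_pseries C_AbsRing C_NormedModule a z l)).
  intros z Hz.
  apply (@iota_correct C_AbsRing C_CompleteNormedModule
    (fun l => @is_pseries C_AbsRing C_NormedModule a z l)).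
  destruct (ex_pseries_bounded a B z HB Hz) as [l Hl].
  exists l. split; [exact Hl|].
  intros l' Hl'. exact (filterlim_locally_unique _ _ _ Hl Hl').
Qed.

(** The derivative is the termwise derivative: summing [Cpow_remainder] over
    [n] bounds the error by a constant times [|w - z|^2], the constant being
    finite because [sum n^2 r^n] converges. *)
Lemma analytic_of_power_series (f : C -> C) (a : nat -> C) (B : R) :
  (forall n, Cmod (a n) <= B) -> has_power_series f a -> analytic_on_disk f.
Proof.
  intros HB Hf z Hz. unfold in_disk in Hz.
  pose proof (Cmod_ge_0 z) as Hz0.
  assert (HB0 : 0 <= B) by (eapply Rle_trans; [apply Cmod_ge_0|apply (HB 0%nat)]).
  (* any radius strictly between [|z|] and [1] works *)
  set (r := (1 + Cmod z) / 2).
  assert (Hr : 0 < r < 1) by (unfold r; lra).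
  destruct (ex_series_sqr_geom r Hr) as [S HS].
  assert (Hd : @ex_series C_AbsRing C_NormedModule
      (fun n => (RtoC (INR n) * z ^ pred n * a n)%C)).
  { apply (@ex_series_le C_AbsRing C_CompleteNormedModule _
      (fun n => (INR n ^ 2 * r ^ n) * (B / r))).
    - intro n. change (Cmod (RtoC (INR n) * z ^ pred n * a n) <= INR n ^ 2 * r ^ n * (B / r)).
      rewrite !Cmod_mult, Cmod_R, Cmod_pow, (Rabs_pos_eq _ (pos_INR n)).
      destruct n as [|n].
      + simpl INR. lra.
      + simpl pred.
        replace (INR (Datatypes.S n) ^ 2 * r ^ Datatypes.S n * (B / r))
          with (INR (Datatypes.S n) ^ 2 * r ^ n * B) by (simpl; field; lra).
        apply Rmult_le_compat; [|apply Cmod_ge_0| |apply HB].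
        * apply Rmult_le_pos; [apply pos_INR|apply pow_le; lra].
        * assert (1 <= INR (Datatypes.S n)) by (rewrite S_INR; pose proof (pos_INR n); lra).
          apply Rmult_le_compat; [lra|apply pow_le; lra| |].
          { rewrite <- (pow_1 (INR _)) at 1. apply Rle_pow; [assumption|lia]. }
          apply pow_incr; unfold r; lra.
    - apply ex_series_scal_r. exists S. exact HS. }
  destruct Hd as [d Hd].
  exists d. split.
  { apply is_linear_scal_l. }
  intros x Hx.
  apply (@is_filter_lim_locally_unique C_AbsRing (AbsRing_NormedModule C_AbsRing)) in Hx.
  subst x. intro eps.
  set (K := S * (B / r ^ 2)).
  assert (HS0 : 0 <= S).
  { apply (is_lim_seq_le (fun _ => 0) (sum_n (fun n => INR n ^ 2 * r ^ n)) 0 S);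
      [|apply is_lim_seq_const|exact HS].
    intro n. apply Rle_trans with (sum_n (fun _ => 0) n).
    { right; symmetry; exact (@sum_n_m_const_zero R_AbelianGroup 0 n). }
    apply sum_n_m_le. intro k.
    apply Rmult_le_pos; [apply pow2_ge_0|apply pow_le; lra]. }
  assert (HK : 0 <= K).
  { apply Rmult_le_pos; [exact HS0|]. apply Rdiv_le_0_compat; [exact HB0|apply pow_lt; lra]. }
  assert (Hdelta : 0 < Rmin (r - Cmod z) (eps / (K + 1))).
  { apply Rmin_pos; [unfold r; lra|]. apply Rdiv_lt_0_compat; [apply cond_pos|lra]. }
  exists (mkposreal _ Hdelta). intros w Hw.
  change (Cmod (w - z) < Rmin (r - Cmod z) (eps / (K + 1))) in Hw.
  change (Cmod (f w - f z - (w - z) * d) <= eps * Cmod (w - z)).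
  assert (Hw1 : Cmod (w - z) < r - Cmod z) by (eapply Rlt_le_trans; [exact Hw|apply Rmin_l]).
  assert (Hw2 : Cmod (w - z) < eps / (K + 1)) by (eapply Rlt_le_trans; [exact Hw|apply Rmin_r]).
  assert (Hwr : Cmod w <= r).
  { replace w with (z + (w - z))%C by ring.
    eapply Rle_trans; [apply Cmod_triangle|lra]. }
  assert (Hwd : in_disk w) by (unfold in_disk; lra).
  pose proof (proj1 (is_pseries_C _ _ _) (Hf z Hz)) as Fz.
  pose proof (proj1 (is_pseries_C _ _ _) (Hf w Hwd)) as Fw.
  pose proof (is_series_minus _ _ _ _ (is_series_minus _ _ _ _ Fw Fz)
    (is_series_scal_l (w - z : C_AbsRing)%C _ _ Hd)) as Frem.
  assert (Hmain : Cmod (f w - f z - (w - z) * d) <= S * (B / r ^ 2 * Cmod (w - z) ^ 2)).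
  { refine (is_series_norm_le _ (fun n => INR n ^ 2 * r ^ n * (B / r ^ 2 * Cmod (w - z) ^ 2))
      _ _ _ Frem _).
    2: { apply (is_series_scal_r (B / r ^ 2 * Cmod (w - z) ^ 2)) in HS. exact HS. }
    intro n.
    match goal with |- norm ?x <= _ => change (norm x) with (Cmod x) end.
    change (Cmod (w ^ n * a n - z ^ n * a n - (w - z) * (RtoC (INR n) * z ^ pred n * a n))
      <= INR n ^ 2 * r ^ n * (B / r ^ 2 * Cmod (w - z) ^ 2)).
    replace (w ^ n * a n - z ^ n * a n - (w - z) * (RtoC (INR n) * z ^ pred n * a n))%C
      with ((w ^ n - z ^ n - (w - z) * (RtoC (INR n) * z ^ pred n)) * a n)%C by ring.
    rewrite Cmod_mult.
    assert (Hzr : Cmod z <= r) by (unfold r; lra).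
    pose proof (Cpow_remainder z w r n (proj1 Hr) Hzr Hwr) as Hrem.
    assert (Hr2 : 0 < r ^ 2) by (apply pow_lt; lra).
    apply (Rmult_le_reg_l (r ^ 2)); [exact Hr2|].
    replace (r ^ 2 * (INR n ^ 2 * r ^ n * (B / r ^ 2 * Cmod (w - z) ^ 2)))
      with (INR n ^ 2 * r ^ n * Cmod (w - z) ^ 2 * B) by (field; lra).
    rewrite <- Rmult_assoc.
    apply Rmult_le_compat; [|apply Cmod_ge_0|exact Hrem|apply HB].
    apply Rmult_le_pos; [lra|apply Cmod_ge_0]. }
  eapply Rle_trans; [exact Hmain|].
  replace (S * (B / r ^ 2 * Cmod (w - z) ^ 2)) with ((K * Cmod (w - z)) * Cmod (w - z))
    by (unfold K; simpl; ring).
  apply Rmult_le_compat_r; [apply Cmod_ge_0|].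
  apply Rle_trans with (K * (eps / (K + 1))); [apply Rmult_le_compat_l; lra|].
  apply (Rmult_le_reg_r (K + 1)); [lra|].
  replace (K * (eps / (K + 1)) * (K + 1)) with (K * eps) by (field; lra).
  pose proof (cond_pos eps). lra.
Qed.

(** * The mean of [1 / |1 - s e^(it)|] *)

(** The square of [|1 - s e^(it)|], in the half-angle form of [chord2_cos]. *)
Definition chord2 (s t : R) : R := (1 - s) ^ 2 + 4 * s * sin (t / 2) ^ 2.

Lemma chord2_cos (s t : R) : (1 - s * cos t) ^ 2 + (s * sin t) ^ 2 = chord2 s t.
Proof.
  unfold chord2.
  replace t with (2 * (t / 2)) at 1 2 by field.
  rewrite cos_2a_sin, sin_2a.
  pose proof (sin2_cos2 (t / 2)) as H; unfold Rsqr in H.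
  set (u := sin (t / 2)) in *; set (v := cos (t / 2)) in *.
  replace ((s * (2 * u * v)) ^ 2) with (4 * s ^ 2 * u ^ 2 * (v * v)) by ring.
  replace (v * v) with (1 - u * u) by lra. ring.
Qed.

Lemma chord2_pos (s t : R) : 0 <= s < 1 -> 0 < chord2 s t.
Proof.
  intro Hs; unfold chord2.
  assert (0 < (1 - s) ^ 2) by (apply pow_lt; lra).
  pose proof (pow2_ge_0 (sin (t / 2))). nra.
Qed.

(** With [y = 2 sqrt s sin (t / 2)] one has [chord2 s t = (1 - s)^2 + y^2] and
    [y' = sqrt s cos (t / 2)]; up to scaling and an additive constant this is
    [arsinh (y / (1 - s))]. *)
Definition chord_primitive (s t : R) : R :=
  ln (2 * sqrt s * sin (t / 2) + sqrt (chord2 s t)) / sqrt s.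

Lemma is_derive_chord_primitive (s t : R) : 0 < s < 1 -> 0 <= sin (t / 2) ->
  is_derive (chord_primitive s) t (cos (t / 2) / sqrt (chord2 s t)).
Proof.
  intros Hs Ht.
  assert (Hq : 0 < sqrt s) by (apply sqrt_lt_R0; lra).
  assert (HD : 0 < chord2 s t) by (apply chord2_pos; lra).
  assert (HsD : 0 < sqrt (chord2 s t)) by (apply sqrt_lt_R0; exact HD).
  assert (H0 : 0 < 2 * sqrt s * sin (t / 2) + sqrt (chord2 s t)) by nra.
  unfold chord_primitive, chord2 in *.
  auto_derive.
  - repeat split; simpl in *; unfold Rdiv in *; try lra.
  - unfold Rdiv in *. rewrite ?Rmult_1_l in *.
    replace ((1 + - s) * ((1 + - s) * 1)) with ((1 - s) ^ 2) by ring.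
    simpl in *.
    match type of HsD with 0 < ?x => set (q := x) in * end.
    field_simplify_eq; [|split; [lra|split;lra]].
    rewrite pow2_sqrt by lra. ring.
Qed.

Lemma continuous_chord_ratio (c s t : R) : 0 < s < 1 ->
  continuous (fun t => c * cos (t / 2) / sqrt (chord2 s t)) t.
Proof.
  intro Hs.
  assert (HD : 0 < chord2 s t) by (apply chord2_pos; lra).
  pose proof (sqrt_lt_R0 _ HD) as HsD.
  apply (@ex_derive_continuous R_AbsRing R_NormedModule).
  unfold chord2 in *. auto_derive. simpl in *. unfold Rdiv, Rminus in *.
  repeat split; lra.
Qed.

(** The integrand lacks the factor [cos (t / 2)] that would make it an exact
    derivative. Inserting [|cos (t / 2)|] costs at most
    [(1 - |cos (t / 2)|) / sqrt (chord2 s t)], and this stays bounded as [s]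
    tends to [1] because [1 - |cos u| <= sin u] and
    [2 sqrt s sin (t / 2) <= sqrt (chord2 s t)]. *)
Lemma inv_chord_le (s t : R) : 0 < s < 1 -> 0 <= sin (t / 2) ->
  / sqrt (chord2 s t)
    <= Rabs (cos (t / 2)) / sqrt (chord2 s t) + / (2 * sqrt s).
Proof.
  intros Hs Ht.
  assert (Hq : 0 < sqrt s) by (apply sqrt_lt_R0; lra).
  assert (HD : 0 < chord2 s t) by (apply chord2_pos; lra).
  assert (HsD : 0 < sqrt (chord2 s t)) by (apply sqrt_lt_R0; exact HD).
  assert (H1 : 2 * sqrt s * sin (t / 2) <= sqrt (chord2 s t)).
  { apply Rsqr_incr_0_var; [|lra]. rewrite Rsqr_sqrt by lra.
    unfold Rsqr. replace (2 * sqrt s * sin (t / 2) * (2 * sqrt s * sin (t / 2)))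
      with (4 * (sqrt s * sqrt s) * sin (t / 2) ^ 2) by ring.
    rewrite sqrt_sqrt by lra. unfold chord2. pose proof (pow2_ge_0 (1 - s)). lra. }
  assert (H2 : 1 - Rabs (cos (t / 2)) <= sin (t / 2)).
  { pose proof (sin2_cos2 (t / 2)) as H; unfold Rsqr in H.
    pose proof (Rabs_pos (cos (t / 2))) as Hc.
    replace (cos (t / 2) * cos (t / 2)) with
      (Rabs (cos (t / 2)) * Rabs (cos (t / 2))) in H
      by (rewrite <- Rabs_mult; apply Rabs_pos_eq; nra).
    nra. }
  apply (Rmult_le_reg_r (2 * sqrt s * sqrt (chord2 s t))); [nra|].
  replace (/ sqrt (chord2 s t) * (2 * sqrt s * sqrt (chord2 s t))) with (2 * sqrt s)
    by (field; lra).
  replace ((Rabs (cos (t / 2)) / sqrt (chord2 s t) + / (2 * sqrt s))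
      * (2 * sqrt s * sqrt (chord2 s t)))
    with (2 * sqrt s * Rabs (cos (t / 2)) + sqrt (chord2 s t)) by (field; lra).
  nra.
Qed.

Lemma chord_primitive_0 (s : R) : 0 < s < 1 ->
  chord_primitive s 0 = ln (1 - s) / sqrt s.
Proof.
  intro Hs. unfold chord_primitive, chord2.
  replace (0 / 2) with 0 by field. rewrite sin_0.
  replace ((1 - s) ^ 2 + 4 * s * 0 ^ 2) with (Rsqr (1 - s)) by (unfold Rsqr; ring).
  rewrite sqrt_Rsqr by lra. do 2 f_equal. ring.
Qed.

Lemma chord_primitive_2PI (s : R) : 0 < s < 1 ->
  chord_primitive s (2 * PI) = ln (1 - s) / sqrt s.
Proof.
  intro Hs. unfold chord_primitive, chord2.
  replace (2 * PI / 2) with PI by field. rewrite sin_PI.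
  replace ((1 - s) ^ 2 + 4 * s * 0 ^ 2) with (Rsqr (1 - s)) by (unfold Rsqr; ring).
  rewrite sqrt_Rsqr by lra. do 2 f_equal. ring.
Qed.

Lemma chord_primitive_PI (s : R) : 0 < s < 1 ->
  chord_primitive s PI <= 3 / sqrt s.
Proof.
  intro Hs. unfold chord_primitive, chord2. rewrite sin_PI2.
  replace ((1 - s) ^ 2 + 4 * s * 1 ^ 2) with (Rsqr (1 + s)) by (unfold Rsqr; ring).
  rewrite sqrt_Rsqr by lra.
  assert (Hq : 0 < sqrt s) by (apply sqrt_lt_R0; lra).
  assert (sqrt s <= 1) by (rewrite <- sqrt_1; apply sqrt_le_1_alt; lra).
  apply Rmult_le_compat_r; [apply Rlt_le, Rinv_0_lt_compat, Hq|].
  set (x := 2 * sqrt s * 1 + (1 + s)).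
  assert (0 < x <= 4) by (unfold x; lra).
  replace 3 with (ln (exp 3)) by apply ln_exp.
  apply ln_le; [lra|]. pose proof (exp_ineq1_le 3). lra.
Qed.

Lemma continuous_inv_chord (s t : R) : 0 <= s < 1 ->
  continuous (fun t => / sqrt (chord2 s t)) t.
Proof.
  intro Hs.
  assert (HD : 0 < chord2 s t) by (apply chord2_pos; lra).
  pose proof (sqrt_lt_R0 _ HD) as HsD.
  apply (@ex_derive_continuous R_AbsRing R_NormedModule).
  unfold chord2 in *. auto_derive. simpl in *. unfold Rdiv, Rminus in *.
  repeat split; lra.
Qed.

(** The sign [c] of [cos (t / 2)] lets one statement serve both halves of the
    circle. *)
Lemma RInt_inv_chord_le_primitive (s a b c : R) : 0 < s < 1 -> a <= b ->
  (forall t, a <= t <= b -> 0 <= sin (t / 2)) ->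
  (forall t, a <= t <= b -> Rabs (cos (t / 2)) = c * cos (t / 2)) ->
  RInt (fun t => / sqrt (chord2 s t)) a b
    <= c * (chord_primitive s b - chord_primitive s a) + (b - a) / (2 * sqrt s).
Proof.
  intros Hs Hab Hsin Hcos.
  assert (Hq : 0 < sqrt s) by (apply sqrt_lt_R0; lra).
  assert (HI : is_RInt (fun t => c * cos (t / 2) / sqrt (chord2 s t) + / (2 * sqrt s)) a b
    (c * (chord_primitive s b - chord_primitive s a) + (b - a) / (2 * sqrt s))).
  { apply (@is_RInt_plus R_NormedModule); [|apply (@is_RInt_const R_NormedModule)].
    replace (c * (chord_primitive s b - chord_primitive s a)) with
      (minus (c * chord_primitive s b) (c * chord_primitive s a))
      by (unfold minus, plus, opp; simpl; ring).
    apply (is_RInt_derive (fun t => c * chord_primitive s t)).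
    - intros t Ht. rewrite Rmin_left, Rmax_right in Ht by exact Hab.
      unfold Rdiv; rewrite Rmult_assoc.
      apply is_derive_scal. apply is_derive_chord_primitive; [exact Hs|apply Hsin, Ht].
    - intros t _. apply continuous_chord_ratio, Hs. }
  rewrite <- (is_RInt_unique _ _ _ _ HI).
  apply RInt_le; [exact Hab| |eexists; exact HI|].
  - apply (@ex_RInt_continuous R_CompleteNormedModule). intros t _.
    apply continuous_inv_chord; lra.
  - intros t Ht. rewrite <- Hcos by lra. apply inv_chord_le; [exact Hs|apply Hsin; lra].
Qed.

Lemma RInt_inv_chord_le (s : R) : 0 < s < 1 ->
  RInt (fun t => / sqrt (chord2 s t)) 0 (2 * PI)
    <= (6 - 2 * ln (1 - s) + PI) / sqrt s.
Proof.
  intro Hs. pose proof PI_RGT_0 as HPI.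
  assert (Hq : 0 < sqrt s) by (apply sqrt_lt_R0; lra).
  assert (Hex : forall a b, ex_RInt (fun t => / sqrt (chord2 s t)) a b).
  { intros a b. apply (@ex_RInt_continuous R_CompleteNormedModule).
    intros t _. apply continuous_inv_chord; lra. }
  rewrite <- (RInt_Chasles _ 0 PI (2 * PI)) by apply Hex.
  change (RInt (fun t => / sqrt (chord2 s t)) 0 PI
    + RInt (fun t => / sqrt (chord2 s t)) PI (2 * PI) <= (6 - 2 * ln (1 - s) + PI) / sqrt s).
  assert (H1 := RInt_inv_chord_le_primitive s 0 PI 1 Hs (Rlt_le _ _ HPI)).
  assert (H2 := RInt_inv_chord_le_primitive s PI (2 * PI) (-1) Hs).
  rewrite chord_primitive_0 in H1 by exact Hs.
  rewrite chord_primitive_2PI in H2 by exact Hs.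
  pose proof (chord_primitive_PI s Hs) as HP.
  assert (E : (6 - 2 * ln (1 - s) + PI) / sqrt s
    = 2 * (3 / sqrt s - ln (1 - s) / sqrt s) + 2 * (PI / (2 * sqrt s))) by (field; lra).
  rewrite E.
  assert (G1 : RInt (fun t => / sqrt (chord2 s t)) 0 PI
    <= 1 * (chord_primitive s PI - ln (1 - s) / sqrt s) + (PI - 0) / (2 * sqrt s)).
  { apply H1; intros t Ht.
    - apply sin_ge_0; lra.
    - rewrite Rmult_1_l. apply Rabs_pos_eq, cos_ge_0; lra. }
  assert (G2 : RInt (fun t => / sqrt (chord2 s t)) PI (2 * PI)
    <= -1 * (ln (1 - s) / sqrt s - chord_primitive s PI) + (2 * PI - PI) / (2 * sqrt s)).
  { apply H2; [lra| |]; intros t Ht.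
    - apply sin_ge_0; lra.
    - replace (-1 * cos (t / 2)) with (- cos (t / 2)) by ring.
      apply Rabs_left1, cos_le_0; lra. }
  replace ((PI - 0) / (2 * sqrt s)) with (PI / (2 * sqrt s)) in G1 by (field; lra).
  replace ((2 * PI - PI) / (2 * sqrt s)) with (PI / (2 * sqrt s)) in G2 by (field; lra).
  lra.
Qed.

(** The coefficient [1 / PI] of the logarithm is what makes the final constant
    sharp; [6] is any constant independent of [s]. [RInt_inv_chord_le] has the
    extra factor [1 / sqrt s], which is harmless for [s > 1/4] because
    [(1 - s) ln (1 / (1 - s)) <= 1]; for small [s] the integrand is at most
    [2]. *)
Lemma mean_inv_chord_le (s : R) : 0 <= s < 1 ->
  / (2 * PI) * RInt (fun t => / sqrt (chord2 s t)) 0 (2 * PI) <= - ln (1 - s) / PI + 6.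
Proof.
  intro Hs. pose proof PI_RGT_0 as HPI. pose proof PI2_1 as HPI2.
  assert (Hln : ln (1 - s) <= 0).
  { rewrite <- ln_1. apply ln_le; lra. }
  assert (Hln2 : - ln (1 - s) * (1 - s) <= 1).
  { rewrite <- ln_Rinv by lra.
    assert (0 < / (1 - s)) by (apply Rinv_0_lt_compat; lra).
    assert (ln (/ (1 - s)) <= / (1 - s)).
    { rewrite <- (ln_exp (/ (1 - s))) at 2. apply ln_le; [assumption|].
      pose proof (exp_ineq1_le (/ (1 - s))). lra. }
    apply Rle_trans with (/ (1 - s) * (1 - s)); [|right; field; lra].
    apply Rmult_le_compat_r; lra. }
  apply (Rmult_le_reg_l (2 * PI)); [lra|].
  rewrite <- Rmult_assoc, Rinv_r, Rmult_1_l by lra.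
  replace (2 * PI * (- ln (1 - s) / PI + 6)) with (2 * - ln (1 - s) + 12 * PI)
    by (field; lra).
  destruct (Rle_lt_dec s (/ 4)) as [Hsmall | Hlarge].
  - assert (Hle : RInt (fun t => / sqrt (chord2 s t)) 0 (2 * PI)
      <= RInt (fun _ => 2) 0 (2 * PI)).
    { apply RInt_le; [lra| |apply ex_RInt_const|].
      - apply (@ex_RInt_continuous R_CompleteNormedModule).
        intros t _. apply continuous_inv_chord; lra.
      - intros t _. rewrite <- (Rinv_inv 2).
        apply Rinv_le_contravar; [lra|].
        rewrite <- (sqrt_Rsqr (/ 2)) by lra. apply sqrt_le_1_alt.
        unfold Rsqr, chord2. pose proof (pow2_ge_0 (sin (t / 2))). nra. }
    rewrite RInt_const in Hle. unfold scal in Hle; simpl in Hle; unfold mult in Hle; simpl in Hle.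
    lra.
  - assert (Hs' : 0 < s < 1) by lra.
    eapply Rle_trans; [apply RInt_inv_chord_le, Hs'|].
    assert (Hq : 0 < sqrt s) by (apply sqrt_lt_R0; lra).
    assert (Hqq : sqrt s * sqrt s = s) by (apply sqrt_sqrt; lra).
    assert (Hq2 : 1 / 2 <= sqrt s) by nra.
    assert (Hq1 : sqrt s <= 1) by nra.
    apply (Rmult_le_reg_r (sqrt s)); [exact Hq|].
    replace ((6 - 2 * ln (1 - s) + PI) / sqrt s * sqrt s) with (6 - 2 * ln (1 - s) + PI)
      by (field; lra).
    set (l := - ln (1 - s)) in *.
    assert (l * (1 - sqrt s) <= 1).
    { apply Rle_trans with (l * (1 - s)); [|exact Hln2].
      apply Rmult_le_compat_l; [unfold l; lra|nra]. }
    assert (0 <= PI * (sqrt s - 1 / 2)) by (apply Rmult_le_pos; lra).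
    replace (ln (1 - s)) with (- l) by (unfold l; ring).
    lra.
Qed.

(** * The Cauchy kernel and its Hilbert transform *)

(** Once convergence is known, the sum [l] is determined by [l - 1 = q l]. *)
Lemma is_series_C_geom (q : C) : Cmod q < 1 -> is_series_C (fun n => (q ^ n)%C) (/ (1 - q))%C.
Proof.
  intro Hq.
  assert (Hex : exists l : C, is_series_C (fun n => (q ^ n)%C) l).
  { destruct (ex_pseries_bounded (fun _ => RtoC 1) 1 q) as [l Hl];
      [intros _; rewrite Cmod_1; lra|exact Hq|].
    exists l. apply is_pseries_C in Hl.
    eapply is_series_ext; [|exact Hl]. intro n. apply Cmult_1_r. }
  destruct Hex as [l Hl1].
  assert (H1 : is_series_C (fun n => (q ^ S n)%C) (l - 1)%C).
  { apply (is_series_incr_1 (fun n => (q ^ n)%C : C_NormedModule)).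
    replace (plus (l - 1 : C_NormedModule)%C (q ^ 0 : C_NormedModule)%C) with l; [exact Hl1|].
    change (@eq C l (l - 1 + 1)%C). ring. }
  assert (H2 : is_series_C (fun n => (q ^ S n)%C) (q * l)%C).
  { exact (is_series_scal_l (q : C_AbsRing) _ _ Hl1). }
  assert (E : @eq C (l - 1)%C (q * l)%C) by exact (filterlim_locally_unique _ _ _ H1 H2).
  assert (Hne : (1 - q)%C <> 0).
  { intro H0. replace q with (RtoC 1) in Hq.
    - rewrite Cmod_1 in Hq; lra.
    - replace (RtoC 1) with ((1 - q) + q)%C by ring. rewrite H0. ring. }
  replace (/ (1 - q))%C with l; [exact Hl1|].
  replace l with (l * (1 - q) / (1 - q))%C by (field; exact Hne).
  replace (l * (1 - q))%C with (l - q * l)%C by ring. rewrite <- E.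
  field. exact Hne.
Qed.

Definition cauchy_kernel (rho : R) (z : C) : C := (/ (1 - rho * z))%C.

Definition kernel_Hilbert_coeff (rho : R) (n : nat) : R :=
  Series (fun k => rho ^ k / INR (n + k + 1)).

Lemma cauchy_kernel_power_series (rho : R) : 0 <= rho < 1 ->
  has_power_series (cauchy_kernel rho) (fun n => RtoC (rho ^ n)).
Proof.
  intros Hrho z Hz. apply is_pseries_C.
  eapply is_series_ext; [|apply is_series_C_geom].
  - intro n. cbv beta. rewrite Cpow_mult_l, RtoC_pow. apply Cmult_comm.
  - rewrite Cmod_mult, Cmod_R, Rabs_pos_eq by lra.
    unfold in_disk in Hz. pose proof (Cmod_ge_0 z). nra.
Qed.

Lemma kernel_Hilbert_coeff_bound (rho : R) (n : nat) : 0 <= rho < 1 ->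
  is_series (fun k => rho ^ k / INR (n + k + 1)) (kernel_Hilbert_coeff rho n) /\
  Cmod (RtoC (kernel_Hilbert_coeff rho n)) <= / (1 - rho).
Proof.
  intro Hrho.
  assert (Hg : is_series (fun k => rho ^ k) (/ (1 - rho))).
  { apply is_series_geom. rewrite Rabs_pos_eq; lra. }
  assert (Hle : forall k, 0 <= rho ^ k / INR (n + k + 1) <= rho ^ k).
  { intro k. assert (0 <= rho ^ k) by (apply pow_le; lra).
    assert (1 <= INR (n + k + 1)) by (apply (le_INR 1); lia).
    split; [apply Rdiv_le_0_compat; lra|].
    apply Rle_div_l; [lra|]. nra. }
  assert (Hs : is_series (fun k => rho ^ k / INR (n + k + 1)) (kernel_Hilbert_coeff rho n)).
  { apply Series_correct. apply (@ex_series_le R_AbsRing R_CompleteNormedModule _ (fun k => rho ^ k)).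
    - intro k. change (Rabs (rho ^ k / INR (n + k + 1)) <= rho ^ k).
      rewrite Rabs_pos_eq; apply Hle.
    - eexists; exact Hg. }
  split; [exact Hs|]. rewrite Cmod_R.
  refine (is_series_norm_le _ _ _ _ _ Hs Hg).
  intro k. change (Rabs (rho ^ k / INR (n + k + 1)) <= rho ^ k).
  rewrite Rabs_pos_eq; apply Hle.
Qed.

Lemma is_Hilbert_cauchy_kernel (rho : R) : 0 <= rho < 1 ->
  exists g, is_Hilbert (cauchy_kernel rho) g /\ g (RtoC 0) = RtoC (kernel_Hilbert_coeff rho 0).
Proof.
  intro Hrho.
  assert (Hb := fun n => proj2 (kernel_Hilbert_coeff_bound rho n Hrho)).
  destruct (has_power_series_exists _ _ Hb) as [g Hg].
  exists g. split.
  - split; [|split].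
    + refine (analytic_of_power_series _ _ 1 _ (cauchy_kernel_power_series rho Hrho)).
      intro n. rewrite Cmod_R, Rabs_pos_eq by (apply pow_le; lra).
      rewrite <- (pow1 n). apply pow_incr; lra.
    + exact (analytic_of_power_series _ _ _ Hb Hg).
    + exists (fun n => RtoC (rho ^ n)), (fun n => RtoC (kernel_Hilbert_coeff rho n)).
      split; [apply cauchy_kernel_power_series, Hrho|split; [|exact Hg]].
      intro n. eapply is_series_ext;
        [|apply is_series_RtoC, (kernel_Hilbert_coeff_bound rho n Hrho)].
      intro k. apply RtoC_div. apply not_0_INR. lia.
  - assert (H0 : in_disk (RtoC 0)) by (unfold in_disk; rewrite Cmod_0; lra).
    exact (filterlim_locally_unique _ _ _ (Hg _ H0) (is_pseries_0 _)).
Qed.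

(** Integrating [sum x^k = 1 / (1 - x)] from [0] to [rho] gives
    [sum rho^(k+1) / (k + 1) = - ln (1 - rho)], that is,
    [rho] times the coefficient. *)
Lemma log_le_kernel_Hilbert_coeff (rho : R) : 0 < rho < 1 ->
  - ln (1 - rho) <= kernel_Hilbert_coeff rho 0.
Proof.
  intro Hrho.
  assert (Hrho' : 0 <= rho < 1) by lra.
  assert (HCV : CV_radius (fun _ => 1) = Finite (/ 1)).
  { apply CV_radius_finite_DAlembert; [intros; lra|lra|].
    apply is_lim_seq_ext with (fun _ => 1); [|apply is_lim_seq_const].
    intros _. rewrite Rdiv_1_r, Rabs_R1. reflexivity. }
  assert (Hin : Rbar_lt (Rabs rho) (CV_radius (fun _ => 1))).
  { rewrite HCV, Rabs_pos_eq by lra. simpl. lra. }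
  assert (HI : is_RInt (PSeries (fun _ => 1)) 0 rho (- ln (1 - rho))).
  { apply is_RInt_ext with (fun x => / (1 - x)).
    - intros x Hx. rewrite Rmin_left, Rmax_right in Hx by lra.
      unfold PSeries. rewrite <- Series_geom by (rewrite Rabs_pos_eq; lra).
      apply Series_ext. intro n. ring.
    - replace (- ln (1 - rho)) with (minus (- ln (1 - rho)) (- ln (1 - 0))).
      2: { unfold minus, plus, opp; simpl. rewrite Rminus_0_r, ln_1. ring. }
      apply (is_RInt_derive (fun x => - ln (1 - x))).
      + intros x Hx. rewrite Rmin_left, Rmax_right in Hx by lra.
        auto_derive; [lra|]. field. lra.
      + intros x Hx. rewrite Rmin_left, Rmax_right in Hx by lra.
        apply (@ex_derive_continuous R_AbsRing R_NormedModule).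
        auto_derive. lra. }
  assert (HP := is_pseries_RInt _ _ Hin).
  rewrite (is_RInt_unique _ _ _ _ HI) in HP.
  assert (HS : is_series (fun k => rho * (rho ^ k / INR (0 + k + 1))) (- ln (1 - rho))).
  { apply is_pseries_R in HP.
    apply (is_series_ext (fun k => PS_Int (fun _ => 1) (S k) * rho ^ S k)).
    - intro k. replace (0 + k + 1)%nat with (S k) by lia.
      change (@eq R (1 / INR (S k) * (rho * rho ^ k)) (rho * (rho ^ k / INR (S k)))).
      field. apply not_0_INR; lia.
    - apply (is_series_incr_1 (fun k => PS_Int (fun _ => 1) k * rho ^ k)).
      match goal with |- is_series _ ?x => replace x with (- ln (1 - rho)); [exact HP|] end.
      change (- ln (1 - rho) = - ln (1 - rho) + 0 * 1). ring. }
  destruct (kernel_Hilbert_coeff_bound rho 0 Hrho') as [Hb _].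
  assert (Hb' := is_series_scal_l rho _ _ Hb).
  assert (E : @eq R (- ln (1 - rho)) (rho * kernel_Hilbert_coeff rho 0))
    by exact (filterlim_locally_unique _ _ _ HS Hb').
  assert (0 <= - ln (1 - rho)).
  { assert (Hln : ln (1 - rho) <= ln 1) by (apply ln_le; lra).
    rewrite ln_1 in Hln. lra. }
  destruct (Rle_lt_dec 0 (kernel_Hilbert_coeff rho 0)); nra.
Qed.

(** * Norm estimates *)

Lemma M1_0 (f : C -> C) : M1 0 f = Cmod (f (RtoC 0)).
Proof.
  unfold M1. pose proof PI_RGT_0.
  rewrite (RInt_ext _ (fun _ => Cmod (f (RtoC 0)))).
  - rewrite RInt_const. unfold scal; simpl; unfold mult; simpl. field. lra.
  - intros t _. now rewrite !Rmult_0_l.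
Qed.

Lemma M1_cauchy_kernel_le (rho r : R) : 0 <= rho < 1 -> 0 <= r < 1 ->
  M1 r (cauchy_kernel rho) <= - ln (1 - rho) / PI + 6.
Proof.
  intros Hrho Hr. pose proof PI_RGT_0 as HPI.
  assert (Hs : 0 <= rho * r <= rho) by nra.
  unfold M1. rewrite (RInt_ext _ (fun t => / sqrt (chord2 (rho * r) t))).
  - eapply Rle_trans; [apply mean_inv_chord_le; lra|].
    apply Rplus_le_compat_r, Rmult_le_compat_r.
    + apply Rlt_le, Rinv_0_lt_compat, HPI.
    + apply Ropp_le_contravar, ln_le; lra.
  - intros t _. unfold cauchy_kernel.
    assert (E : Cmod (1 - rho * ((r * cos t)%R, (r * sin t)%R))%C = sqrt (chord2 (rho * r) t)).
    { rewrite <- chord2_cos. unfold Cmod. f_equal. simpl. ring. }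
    rewrite Cmod_inv.
    + now rewrite E.
    + apply Cmod_gt_0. rewrite E. apply sqrt_lt_R0, chord2_pos. lra.
Qed.

(** Positivity, which makes the quotient of norms meaningful, comes from the
    radius [0], where the mean of the kernel is [1]. *)
Lemma H1_norm_cauchy_kernel (rho : R) : 0 <= rho < 1 ->
  exists N : R, H1_norm (cauchy_kernel rho) = Finite N /\
    0 < N <= - ln (1 - rho) / PI + 6.
Proof.
  intro Hrho. unfold H1_norm.
  match goal with |- context [Lub_Rbar ?E] => destruct (Lub_Rbar_correct E) as [Hub Hleast] end.
  assert (H1 : Rbar_le 1 (Lub_Rbar (fun x => exists r, 0 <= r < 1 /\ x = M1 r (cauchy_kernel rho)))).
  { apply Hub. exists 0. split; [lra|]. rewrite M1_0. unfold cauchy_kernel.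
    replace (/ (1 - rho * 0))%C with (RtoC 1); [symmetry; apply Cmod_1|].
    rewrite Cmult_0_r. unfold Cminus. rewrite Copp_0, Cplus_0_r. field. }
  assert (H2 : Rbar_le (Lub_Rbar (fun x => exists r, 0 <= r < 1 /\ x = M1 r (cauchy_kernel rho)))
     (- ln (1 - rho) / PI + 6)).
  { apply Hleast. intros x [r [Hr ->]]. apply M1_cauchy_kernel_le; assumption. }
  destruct (Lub_Rbar _) as [N | |]; [|contradiction H2|contradiction H1].
  exists N. simpl in H1, H2. split; [reflexivity|lra].
Qed.

Lemma Cmod_0_le_H1log_norm (g : C -> C) : Rbar_le (Cmod (g (RtoC 0))) (H1log_norm g).
Proof.
  apply Lub_Rbar_correct. exists 0. split; [lra|].
  rewrite M1_0. replace (exp 1 / (1 - 0) ^ 2) with (exp 1) by field.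
  rewrite ln_exp. field.
Qed.

Lemma Rbar_le_div (x : R) (y : Rbar) (N : R) : 0 < N ->
  Rbar_le (x * N) y -> Rbar_le x (Rbar_div y N).
Proof.
  intros HN Hy. destruct y as [y | |]; simpl in Hy; [| |contradiction].
  - simpl. apply Rle_div_r; assumption.
  - change (Rbar_le x (Rbar_mult p_infty (Finite (/ N)))).
    rewrite (is_Rbar_mult_unique _ _ _ (is_Rbar_mult_p_infty_pos (Finite (/ N))
      (Rinv_0_lt_compat _ HN))).
    exact I.
Qed.

Lemma Hilbert_norm_ge (rho m : R) : 0 < rho < 1 -> 0 <= m ->
  m * (- ln (1 - rho) / PI + 6) <= - ln (1 - rho) -> Rbar_le m Hilbert_norm_H1_H1log.
Proof.
  intros Hrho Hm Hle.
  assert (Hrho' : 0 <= rho < 1) by lra.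
  destruct (is_Hilbert_cauchy_kernel rho Hrho') as [g [Hg Hg0]].
  destruct (H1_norm_cauchy_kernel rho Hrho') as [N [HN [HN0 HN1]]].
  apply Rbar_le_trans with (Rbar_div (H1log_norm g) (H1_norm (cauchy_kernel rho))).
  - rewrite HN. apply Rbar_le_div; [exact HN0|].
    apply Rbar_le_trans with (Cmod (g (RtoC 0))); [|apply Cmod_0_le_H1log_norm].
    rewrite Hg0, Cmod_R.
    pose proof (log_le_kernel_Hilbert_coeff rho Hrho).
    pose proof (Rle_abs (kernel_Hilbert_coeff rho 0)).
    simpl. assert (m * N <= m * (- ln (1 - rho) / PI + 6)) by (apply Rmult_le_compat_l; lra).
    lra.
  - unfold Hilbert_norm_H1_H1log, Rbar_lub.
    match goal with |- context [Rbar_ex_lub ?E] => destruct (Rbar_ex_lub E) as [l Hl] end.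
    apply Hl. exists (cauchy_kernel rho), g.
    split; [|split; [|split; [exact Hg|reflexivity]]].
    + split; [apply Hg|]. rewrite HN. exact I.
    + exists (RtoC 0). split; [unfold in_disk; rewrite Cmod_0; lra|].
      unfold cauchy_kernel. rewrite Cmult_0_r. unfold Cminus.
      rewrite Copp_0, Cplus_0_r, <- RtoC_inv by lra. intro H; apply RtoC_inj in H. lra.
Qed.

Theorem theorem4p2 : Rbar_le (Finite PI) Hilbert_norm_H1_H1log.
Proof.
  pose proof PI2_1 as HPI.
  apply Rbar_not_lt_le. intro Hlt.
  assert (Hm : exists m, 1 <= m < PI /\ Rbar_lt Hilbert_norm_H1_H1log m).
  { destruct Hilbert_norm_H1_H1log as [h | |]; simpl in Hlt; [|contradiction|].
    - exists (Rmax 1 ((h + PI) / 2)). unfold Rmax. simpl. destruct Rle_dec; lra.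
    - exists 1. simpl. split; [lra|exact I]. }
  destruct Hm as [m [Hm Hnm]].
  apply (Rbar_lt_not_le _ _ Hnm).
  (* the solution of [m * (L / PI + 6) = L]; then [rho = 1 - exp (- L)] *)
  set (L := 6 * m * PI / (PI - m)).
  assert (HL : 0 < L) by (apply Rdiv_lt_0_compat; nra).
  pose proof (exp_pos (- L)).
  assert (exp (- L) < 1).
  { rewrite <- exp_0. apply exp_increasing. lra. }
  apply (Hilbert_norm_ge (1 - exp (- L))); [lra|lra|].
  replace (1 - (1 - exp (- L))) with (exp (- L)) by ring.
  rewrite ln_exp. right. unfold L. field. lra.
Qed.
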